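(* Let $p$ be an odd prime and $q$ a prime with $q\equiv 1\pmod{p^2}$, and let $h$ be a fixed element of order $p^2$ in $\mathbb{Z}_q^\times$. For $0\le j\le p-1$ let $f_j:\mathbb{Z}_{p^2}\to\mathbb{Z}_{p^2}$ be the bijection $f_j(m)=\frac{m(m-1)}{2}jp+m$. Up to isomorphism, the left braces of size $p^2q$ with cyclic additive group and with $|\ker\lambda|=q$ are exactly the braces $B_j$ for $0\le j\le p-1$, distinct $j$ giving non-isomorphic braces, where $B_j=(\mathbb{Z}_{p^2}\times\mathbb{Z}_q,+,\circ)$ with $$\begin{pmatrix} n\\ m\end{pmatrix}+\begin{pmatrix} x\\ y\end{pmatrix}=\begin{pmatrix} n+x\\ m+y\end{pmatrix},\qquad \begin{pmatrix} n\\ m\end{pmatrix}\circ\begin{pmatrix} x\\ y\end{pmatrix}=\begin{pmatrix} n+\big(f_j^{-1}(n)pj+1\big)x\\ m+h^{f_j^{-1}(n)}y\end{pmatrix}$$ for all $n,x\in\mathbb{Z}_{p^2}$ and $m,y\in\mathbb{Z}_q$. In particular, $(B_j,\circ)\cong\mathbb{Z}_q\rtimes_h\mathbb{Z}_{p^2}$.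
   Context: A skew (left) brace is a triple $(B,+,\circ)$ where $(B,+)$ and $(B,\circ)$ are groups such that $a\circ(b+c)=a\circ b-a+a\circ c$ for all $a,b,c\in B$; it is a left brace if $(B,+)$ is abelian. The map $\lambda:(B,\circ)\to\mathrm{Aut}(B,+)$, $\lambda_a(b)=-a+a\circ b$, is a group homomorphism, with kernel $\ker\lambda$. Isomorphisms are bijections preserving both operations. $\mathbb{Z}_q\rtimes_h\mathbb{Z}_{p^2}=\langle\sigma,\tau\mid\tau^q=\sigma^{p^2}=1,\ \sigma\tau\sigma^{-1}=\tau^h\rangle$. *)

(* Defs.v *)
From HB Require Import structures.
From mathcomp Require Import all_boot all_order all_fingroup all_algebra.
From mathcomp Require Import all_solvable.

Set Implicit Arguments.
Unset Strict Implicit.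
Unset Printing Implicit Defensive.

Import GRing.Theory.
Local Open Scope ring_scope.

(* MathComp declares the finType and zmodType structures of a product, but not
   their join finZmodType; the addition is the componentwise one. *)
HB.instance Definition _ (U V : finZmodType) := Finite.on (U * V)%type.

(* A left brace whose additive group is the given abelian group T: the
   additive structure comes from T, the record supplies the operation
   a o b. The neutral element and the inverses of o are determined by o. *)
Record leftBrace (T : finZmodType) := LeftBrace {
  circ : T -> T -> T;
  circ_one : T;
  circ_inv : T -> T;
  circA : associative circ;
  circ1b : left_id circ_one circ;
  circVb : left_inverse circ_one circ_inv circ;
  circ_brace : forall a b c : T, circ a (b + c) = circ a b - a + circ a c
}.

(* The group (B, o), on an alias of T: T itself carries the additive group. *)
Definition circ_group (T : finZmodType) (B : leftBrace T) : Type := T.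

HB.instance Definition _ (T : finZmodType) (B : leftBrace T) :=
  Finite.copy (circ_group B) T.
HB.instance Definition _ (T : finZmodType) (B : leftBrace T) :=
  Finite_isGroup.Build (circ_group B)
    (@circA T B) (@circ1b T B) (@circVb T B).

Definition lambda (T : finZmodType) (B : leftBrace T) (a b : T) : T :=
  - a + circ B a b.

Definition ker_lambda (T : finZmodType) (B : leftBrace T) : {set T} :=
  [set a | [forall b, lambda B a b == b]].

Definition brace_isom (T U : finZmodType) (B : leftBrace T) (C : leftBrace U) :
    Prop :=
  exists f : T -> U,
    [/\ bijective f,
        forall a b, f (a + b) = f a + f b
      & forall a b, f (circ B a b) = circ C (f a) (f b)].

(* The division by 2 is that of the ring 'Z_(p ^ 2), in which 2 is invertible
   when p is odd. *)
Definition f_ (p j : nat) (m : 'Z_(p ^ 2)) : 'Z_(p ^ 2) :=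
  m * (m - 1) / 2%:R * j%:R * p%:R + m.

(* finv is the inverse function of an injective map of a finite type to
   itself. The exponent of h is a representative in nat of a class modulo
   p ^ 2, which is harmless for h of order p ^ 2. *)
Definition circ_ (p q : nat) (h : {unit 'Z_q}) (j : nat)
    (u v : 'Z_(p ^ 2) * 'Z_q) : 'Z_(p ^ 2) * 'Z_q :=
  let: (n, m) := u in let: (x, y) := v in
  let k := finv (@f_ p j) n in
  (n + (k * p%:R * j%:R + 1) * x, m + val h ^+ k * y).

(* Main.v *)
Require Import Defs.
From HB Require Import structures.
From mathcomp Require Import all_boot all_order all_fingroup all_algebra.
From mathcomp Require Import all_solvable.
From mathcomp Require Import ring.

Set Implicit Arguments.
Unset Strict Implicit.
Unset Printing Implicit Defensive.

Import GRing.Theory.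
Local Open Scope ring_scope.

(* The law f(k + l) = f(k) + (k p j + 1) f(l) turns o into
   (f(k), m) o (f(l), y) = (f(k + l), m + h^k y), so B_j is a brace with the
   stated multiplicative group.  Conversely, let T be additively generated by x
   and ker lambda have order q.  Every lambda_a is multiplication by an integer,
   and ker lambda is the subgroup generated by t = p^2 x.  For P = q x,
   lambda_P is multiplication by some c with c = 1 mod p, because c^(p^2 q) = 1
   and c^(p - 1) = 1 mod p.  With c = 1 + p s mod p^2, the k-th o-power of P is
   f_s(k) P; in particular the p-th one is p P, outside ker lambda, so c has
   order exactly p^2 mod q and h = c^r for some r.  The r-th o-power g of P
   generates the same additive group as P, and (n, m) |-> n g + m t is the
   isomorphism from B_j, where c^r = 1 + p j mod p^2.  An isomorphism between
   B_i and B_j fixes (1, 0), since lambda_(1, 0) acts on Z_q as h; comparing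
   the actions of lambda_(1, 0) on Z_(p^2) then gives i = j. *)

(** * The bijections f_j and arithmetic modulo p^2 *)

(** Passing from k and l to k + l adds the cross term 2 k l to k(k - 1) + l(l - 1). Halved by [w],
    it matches the product of k P J with the linear term l; the remaining product carries P^2 =
    0. *)
Lemma triangD (R : comPzRingType) (w P J k l : R) :
  2%:R * w = 1 -> P * P = 0 ->
  (k + l) * (k + l - 1) * w * J * P + (k + l) =
  k * (k - 1) * w * J * P + k
  + (k * P * J + 1) * (l * (l - 1) * w * J * P + l).
Proof.
move=> w2 P2; apply/eqP; rewrite -subr_eq0; apply/eqP.
set d := (LHS in LHS = _).
have ->: d = (2%:R * w - 1) * (k * l * J * P)
             - (P * P) * (k * J * (l * (l - 1) * w * J)) by rewrite /d; ring.
by rewrite w2 P2 subrr !mul0r subr0.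
Qed.

(** The difference of the two values is (k - l)(1 + z P) with z = (k + l - 1) w J, and 1 + z P has
    inverse 1 - z P because P^2 = 0. *)
Lemma triang_inj (R : comPzRingType) (w P J k l : R) : P * P = 0 ->
  k * (k - 1) * w * J * P + k = l * (l - 1) * w * J * P + l -> k = l.
Proof.
move=> P2 /eqP; rewrite -subr_eq0 => /eqP e; apply/eqP; rewrite -subr_eq0.
apply/eqP; set z := (k + l - 1) * w * J.
have ->: k - l = (k * (k - 1) * w * J * P + k - (l * (l - 1) * w * J * P + l))
   * (1 - z * P) + P * P * (z * z * (k - l)) by rewrite /z; ring.
by rewrite e P2 !mul0r addr0.
Qed.

Section ZpSquared.
Variables p : nat.
Hypotheses (p_pr : prime p) (p_odd : odd p).

Lemma sqr_prime_gt1 : (1 < p ^ 2)%N.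
Proof. by rewrite -(exp1n 2) ltn_exp2r // prime_gt1. Qed.

Lemma char_Zp2 : p%:R * p%:R = 0 :> 'Z_(p ^ 2).
Proof. by rewrite -natrM mulnn pchar_Zp // sqr_prime_gt1. Qed.

Lemma half_Zp2 : 2%:R * 2%:R^-1 = 1 :> 'Z_(p ^ 2).
Proof.
rewrite mulrV // unitZpE ?sqr_prime_gt1 // coprimeXl //.
by rewrite coprime_sym coprime2n.
Qed.

Lemma f_inj j : injective (@f_ p j).
Proof. by move=> k l; apply: (triang_inj char_Zp2). Qed.

Lemma f_add j k l :
  f_ j (k + l) = f_ j k + (k * p%:R * j%:R + 1) * f_ j l :> 'Z_(p ^ 2).
Proof. exact: (triangD _ _ _ half_Zp2 char_Zp2). Qed.

Lemma f_0 j : f_ j 0 = 0 :> 'Z_(p ^ 2).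
Proof. by rewrite /f_ !mul0r addr0. Qed.

Lemma f_1 j : f_ j 1 = 1 :> 'Z_(p ^ 2).
Proof. by rewrite /f_ subrr mulr0 !mul0r add0r. Qed.

Lemma f_p j : f_ j p%:R = p%:R :> 'Z_(p ^ 2).
Proof.
rewrite /f_; set w := _^-1.
have ->: p%:R * (p%:R - 1) * w * j%:R * p%:R =
  p%:R * p%:R * ((p%:R - 1) * w * j%:R) :> 'Z_(p ^ 2) by ring.
by rewrite char_Zp2 mul0r add0r.
Qed.

(** Binomial expansion cut off by p^2 = 0. It identifies the multiplier k p j + 1 in the law of B_j
    with a k-th power. *)
Lemma exp1Dp j k :
  (1 + p%:R * j%:R) ^+ k = k%:R * p%:R * j%:R + 1 :> 'Z_(p ^ 2).
Proof.
elim: k => [|k IHk]; first by rewrite expr0 !mul0r add0r.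
rewrite exprS IHk -natr1; set P := p%:R; set J := j%:R; set K := k%:R.
have ->: (1 + P * J) * (K * P * J + 1) =
  (K + 1) * P * J + 1 + P * P * (K * J * J) by ring.
by rewrite char_Zp2 mul0r addr0.
Qed.

End ZpSquared.

(** * Generalities on left braces and the map lambda *)

Section BraceTheory.
Variables (T : finZmodType) (C : leftBrace T).
Implicit Types a b : T.

Lemma circE a b : circ C a b = a + lambda C a b.
Proof. by rewrite /lambda addrA subrr add0r. Qed.

Lemma lambdaD a b c : lambda C a (b + c) = lambda C a b + lambda C a c.
Proof. by rewrite /lambda circ_brace !addrA. Qed.

Lemma lambda0r a : lambda C a 0 = 0.
Proof. by apply: (addrI (lambda C a 0)); rewrite -lambdaD !addr0. Qed.

Lemma circ_oneE : circ_one C = 0.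
Proof. by have := circ1b C 0; rewrite circE lambda0r addr0. Qed.

Lemma lambda0l b : lambda C 0 b = b.
Proof. by rewrite /lambda oppr0 add0r -circ_oneE circ1b. Qed.

Lemma lambdaMn a b n : lambda C a (b *+ n) = lambda C a b *+ n.
Proof.
by elim: n => [|n IHn]; rewrite ?lambda0r // !mulrS lambdaD IHn.
Qed.

(** Associativity of o, with b o c written as b + lambda_b(c) and expanded by the brace law. *)
Lemma lambda_circ a b c : lambda C (circ C a b) c = lambda C a (lambda C b c).
Proof.
rewrite {1}/lambda -circA (circE b c) circ_brace !addrA addNr add0r.
by rewrite /lambda.
Qed.

Lemma ker_lambdaP a :
  reflect (forall b, lambda C a b = b) (a \in ker_lambda C).
Proof. by rewrite inE; apply: (iffP forallP) => H b; apply/eqP. Qed.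

(** The group law here is addition. On the kernel a + b = a o b, so closure follows from the
    multiplicativity of lambda. *)
Lemma ker_lambda_group_set : group_set (ker_lambda C).
Proof.
apply/group_setP; split; first by apply/ker_lambdaP => b; rewrite lambda0l.
move=> a b /ker_lambdaP Ka /ker_lambdaP Kb; apply/ker_lambdaP => c.
by rewrite FinRing.zmodMgE -{1}(Ka b) -circE lambda_circ Kb Ka.
Qed.

Canonical ker_lambda_group := group ker_lambda_group_set.

Lemma circ_groupM (a b : circ_group C) : (a * b)%g = circ C a b :> T.
Proof. by []. Qed.

Lemma circ_group1 : 1%g = 0 :> circ_group C.
Proof. exact: circ_oneE. Qed.

Lemma lambda_expg (a : circ_group C) c k :
  (forall b, lambda C a b = b *+ c) ->
  forall b, lambda C (a ^+ k)%g b = b *+ (c ^ k).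
Proof.
move=> aE; elim: k => [|k IHk] b; first by rewrite expg0 circ_group1 lambda0l.
by rewrite expgSr circ_groupM lambda_circ aE IHk expnS mulrnA.
Qed.

End BraceTheory.

(** * The model braces B_j *)

Section Model.
Variables (p q : nat) (h : {unit 'Z_q}).
Hypotheses (p_pr : prime p) (p_odd : odd p) (q_pr : prime q).
Hypotheses (q1 : q = 1 %[mod p ^ 2]) (oh : #[h]%g = (p ^ 2)%N).

Local Notation f := (@f_ p).
Let p2_gt1 := sqr_prime_gt1 p_pr.
Let q_gt1 := prime_gt1 q_pr.

Lemma sqr_prime_ltn : (p ^ 2 < q)%N.
Proof.
rewrite ltnNge; apply/negP => q_le.
case: (ltngtP q (p ^ 2)) q_le => // [lt_q _ | eq_q _].
  by move: q1 q_gt1; rewrite !modn_small // => ->.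
by move: q1; rewrite eq_q modnn modn_small.
Qed.

Lemma coprime_p2q : coprime (p ^ 2) q.
Proof.
rewrite coprime_sym prime_coprime // gtnNdvd //; last exact: sqr_prime_ltn.
by rewrite expn_gt0 prime_gt0.
Qed.

(** The representative of k + l is the sum of the representatives up to a multiple of p^2, the order
    of h. *)
Lemma val_expD (k l : 'Z_(p ^ 2)) :
  val h ^+ (k + l)%R = val h ^+ k * val h ^+ l.
Proof. by rewrite -!FinRing.val_unitX expgD_Zp ?oh // -ltnS ltnW. Qed.

Lemma val_exp_inj (k l : 'Z_(p ^ 2)) : val h ^+ k = val h ^+ l -> k = l.
Proof.
rewrite -!FinRing.val_unitX => /val_inj/eqP.
by rewrite eq_expg_mod_order oh -!val_Zp_nat // !natr_Zp => /eqP/val_inj.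
Qed.

Lemma val_exp_natr k : val h ^+ (k%:R : 'Z_(p ^ 2)) = val h ^+ k.
Proof.
by rewrite val_Zp_nat // -!FinRing.val_unitX expg_mod // -oh expg_order.
Qed.

Lemma val_exp1 : val h ^+ (1%R : 'Z_(p ^ 2)) = val h.
Proof. by rewrite -[1]/(1%:R) val_exp_natr. Qed.

(** Writing the first coordinate as f_j(k) removes the inverse function from the law; all later
    computations use this parametrization. *)
Lemma circ_fE j k m x y :
  circ_ h j (f j k, m) (x, y) =
  (f j k + (k * p%:R * j%:R + 1) * x, m + val h ^+ k * y).
Proof. by rewrite /circ_ (finv_f (@f_inj _ p_pr j)). Qed.

Lemma circ_1E j (x : 'Z_(p ^ 2)) y :
  circ_ h j (1, 0) (x, y) = (1 + (p%:R * j%:R + 1) * x, val h * y).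
Proof. by rewrite -{1}(f_1 p j) circ_fE f_1 val_exp1 mul1r add0r. Qed.

Lemma circ_0E j m (x : 'Z_(p ^ 2)) y : circ_ h j (0, m) (x, y) = (x, m + y).
Proof. by rewrite -{1}(f_0 p j) circ_fE f_0 !mul0r !add0r !mul1r. Qed.

Lemma circ_ffE j k m l y :
  circ_ h j (f j k, m) (f j l, y) = (f j (k + l), m + val h ^+ k * y).
Proof. by rewrite circ_fE f_add. Qed.

Lemma f_surj j (n : 'Z_(p ^ 2)) : exists k, n = f j k.
Proof. by exists (finv (f j) n); rewrite (f_finv (@f_inj _ p_pr j)). Qed.

Lemma model_brace j : exists C : leftBrace ('Z_(p ^ 2) * 'Z_q)%type,
  forall u v, circ C u v = circ_ h j u v.
Proof.
(* In the coordinates (k, m) the law is that of a semidirect product, whose inverse is (-k, -h^(-k)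
   m). *)
pose inv (u : 'Z_(p ^ 2) * 'Z_q) :=
  let k := finv (f j) u.1 in (f j (- k), - (val h ^+ (- k)%R * u.2)).
have cA : associative (@circ_ p q h j).
  move=> [n m] [x y] [z t].
  have [k ->] := f_surj j n; have [l ->] := f_surj j x.
  have [r ->] := f_surj j z.
  by rewrite !circ_ffE addrA val_expD mulrDr !addrA mulrA.
have c1 : left_id 0 (@circ_ p q h j).
  by move=> [x y]; rewrite -[0]/(0, 0) circ_0E add0r.
have cV : left_inverse 0 inv (@circ_ p q h j).
  move=> [n m]; have [k ->] := f_surj j n.
  have ->: inv (f j k, m) = (f j (- k), - (val h ^+ (- k)%R * m)).
    by rewrite /inv (finv_f (@f_inj _ p_pr j)).
  by rewrite circ_ffE !addNr f_0.
(* Left multiplication by a is an additive map followed by translation by a. *)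
have cB (a b c : 'Z_(p ^ 2) * 'Z_q) :
    circ_ h j a (b + c) = circ_ h j a b - a + circ_ h j a c.
  case: a b c => n m [x y] [z t]; have [k ->] := f_surj j n.
  rewrite -[(x, y) + _]/(x + z, y + t) !circ_fE.
  by congr (_, _) => /=; ring.
by exists (LeftBrace cA c1 cV cB).
Qed.

Lemma model_isoms (i j : nat) (C D : leftBrace ('Z_(p ^ 2) * 'Z_q)%type) :
  (forall u v, circ C u v = circ_ h i u v) ->
  (forall u v, circ D u v = circ_ h j u v) ->
  brace_isom C D -> i = j %[mod p].
Proof.
move=> CE DE [F [F_bij FD Fcirc]].
have F0 : F 0 = 0 by apply: (addrI (F 0)); rewrite -FD !addr0.
have FMn a n : F (a *+ n) = F a *+ n.
  by elim: n => [|n IHn]; rewrite ?mulr0n // !mulrS FD IHn.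
have pairMn (x : 'Z_(p ^ 2)) (y : 'Z_q) n : (x, y) *+ n = (x *+ n, y *+ n).
  by elim: n => [|n IHn] //; rewrite !mulrS IHn.
have p2_unit : (p ^ 2)%:R \is a @GRing.unit 'Z_q.
  by rewrite unitZpE // coprime_sym coprime_p2q.
have q_unit : q%:R \is a @GRing.unit 'Z_(p ^ 2).
  by rewrite unitZpE // coprime_p2q.
(* (n, 0) is killed by p^2, which is invertible modulo q, so its image has no component in Z_q. The
   next step exchanges the roles of p^2 and q. *)
have [u Fu] : exists u, forall n, F (n, 0) = (u * n, 0).
  have F2 n : (F (n, 0)).2 = 0.
    apply: (mulIr p2_unit); rewrite mul0r mulr_natr.
    have := congr1 snd (FMn (n, 0) (p ^ 2)%N).
    rewrite pairMn -(mulr_natr n) pchar_Zp // mulr0 mul0rn F0 /=.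
    by case: (F _) => x y; rewrite pairMn /= => <-.
  exists (F (1, 0)).1 => n; rewrite -{1}(natr_Zp n).
  have ->: (n%:R, 0) = (1, 0) *+ n :> 'Z_(p ^ 2) * 'Z_q.
    by rewrite pairMn mul0rn.
  rewrite FMn; have := F2 1; case: (F _) => x y /= ->.
  by rewrite pairMn mul0rn -[X in x * X]natr_Zp mulr_natr.
have [v Fv] : exists v, forall m, F (0, m) = (0, m * v).
  have F1 m : (F (0, m)).1 = 0.
    apply: (mulIr q_unit); rewrite mul0r mulr_natr.
    have := congr1 fst (FMn (0, m) q).
    rewrite pairMn -(mulr_natr m) pchar_Zp // mulr0 mul0rn F0 /=.
    by case: (F _) => x y; rewrite pairMn /= => <-.
  exists (F (0, 1)).2 => m; rewrite -{1}(natr_Zp m).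
  have ->: (0, m%:R) = (0, 1) *+ m :> 'Z_(p ^ 2) * 'Z_q.
    by rewrite pairMn mul0rn.
  rewrite FMn; have := F1 1; case: (F _) => x y /= ->.
  by rewrite pairMn mul0rn -[X in X * y]natr_Zp mulr_natl.
have v_unit : v \is a GRing.unit.
  have [G FK GK] := F_bij; pose w := G (0, 1).
  have /(congr1 snd) : F (w.1, 0) + F (0, w.2) = (0, 1).
    rewrite -FD -[_ + _]/(w.1 + 0, 0 + w.2) addr0 add0r.
    by rewrite -surjective_pairing GK.
  rewrite Fu Fv /= add0r => wv.
  by apply/unitrP; exists w.2; rewrite [v * _]mulrC.
(* With u = f_j(k), comparing second coordinates of the images of (1, 0) o (0, 1) gives h v = h^k v,
   hence k = 1. *)
have {F_bij} u1 : u = 1.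
  have [k uk] := f_surj j u.
  have := Fcirc (1, 0) (0, 1); rewrite CE DE circ_1E mulr0 addr0 mulr1.
  rewrite -[X in F (X, _)]add0r -[X in F (_, X)]addr0.
  rewrite -[(_ + _, _ + _)]/((0, val h) + (1, 0)) FD !Fu !Fv mulr1 mul1r uk.
  rewrite circ_fE mulr0 addr0 add0r => /(congr1 snd).
  rewrite -[LHS]/(val h * v + 0) -[RHS]/(val h ^+ k * v) addr0.
  move=> /(mulIr v_unit); rewrite -val_exp1 => /val_exp_inj <-.
  exact: f_1.
have := Fcirc (1, 0) (1, 0); rewrite CE DE !Fu u1 !mul1r !circ_1E !mulr1 mulr0.
rewrite Fu u1 mul1r => /(congr1 fst) /=.
rewrite -[LHS]/(1 + (p%:R * i%:R + 1)) -[RHS]/(1 + (p%:R * j%:R + 1)).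
move=> /addrI /addIr.
rewrite -!natrM => /(congr1 (@nat_of_ord _)); rewrite !val_Zp_nat //.
by rewrite -mulnn -!muln_modr => /eqP; rewrite eqn_pmul2l ?prime_gt0 // => /eqP.
Qed.

Lemma model_lambda j (C : leftBrace ('Z_(p ^ 2) * 'Z_q)%type) k m x y :
  (forall u v, circ C u v = circ_ h j u v) ->
  lambda C (f j k, m) (x, y) = ((k * p%:R * j%:R + 1) * x, val h ^+ k * y).
Proof.
by move=> CE; rewrite /lambda CE circ_fE; congr (_, _) => /=; ring.
Qed.

(** The kernel is the factor Z_q: an element (f_j(k), m) multiplies (0, 1) by h^k, which is trivial
    only for k = 0. *)
Lemma card_ker_model j (C : leftBrace ('Z_(p ^ 2) * 'Z_q)%type) :
  (forall u v, circ C u v = circ_ h j u v) -> #|ker_lambda C| = q.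
Proof.
move=> CE.
have ->: ker_lambda C = [set (0, m) | m : 'Z_q].
  apply/setP=> -[n m]; have [k ->] := f_surj j n.
  apply/ker_lambdaP/imsetP => [K | [m' _ /(congr1 fst) fk0] [x y]].
    exists m => //; congr (_, _).
    have := K (0, 1); rewrite (model_lambda _ _ _ _ CE) => /(congr1 snd).
    rewrite -[LHS]/(val h ^+ k * 1) -[RHS]/(val h ^+ (0%R : 'Z_(p ^ 2))) mulr1.
    by move/val_exp_inj->; rewrite f_0.
  rewrite (model_lambda _ _ _ _ CE).
  have -> : k = 0 by apply: (@f_inj _ p_pr j); rewrite f_0; apply: fk0.
  by rewrite !mul0r add0r !mul1r.
by rewrite card_imset ?card_ord ?Zp_cast // => m m' [].
Qed.

Lemma isom_model j (T : finZmodType) (B : leftBrace T)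
    (C : leftBrace ('Z_(p ^ 2) * 'Z_q)%type) :
  (forall u v, circ C u v = circ_ h j u v) -> brace_isom B C ->
  [/\ #|T| = (p ^ 2 * q)%N, cyclic [set: T] & #|ker_lambda B| = q].
Proof.
move=> CE [F [F_bij FD Fcirc]]; have [G FK GK] := F_bij.
have F0 : F 0 = 0 by apply: (addrI (F 0)); rewrite -FD !addr0.
have FMn a n : F (a *+ n) = F a *+ n.
  by elim: n => [|n IHn]; rewrite ?mulr0n // !mulrS FD IHn.
have FN a : F (- a) = - F a.
  by apply: (addrI (F a)); rewrite -FD !subrr F0.
have Flambda a b : F (lambda B a b) = lambda C (F a) (F b).
  by rewrite /lambda FD FN Fcirc.
have cT : #|T| = (p ^ 2 * q)%N.
  by rewrite (bij_eq_card F_bij) card_prod !card_ord !Zp_cast.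
split=> //.
  (* The order of (1, 1) is divisible by the coprime numbers p^2 and q. *)
  apply/cyclicP; exists (G (1, 1)); apply/eqP.
  rewrite eq_sym eqEcard subsetT cardsT cT.
  rewrite dvdn_leq ?order_gt0 // Gauss_dvd ?coprime_p2q //.
  have /(congr1 F) := expg_order (G (1, 1)).
  rewrite FinRing.zmodXgE FinRing.zmod1gE FMn GK F0; set n := #[_]%g.
  have -> : (1, 1) *+ n = (n%:R, n%:R) :> 'Z_(p ^ 2) * 'Z_q.
    by elim: (n) => // i IHi; rewrite !mulrS IHi.
  case=> /(congr1 (@nat_of_ord _)) /eqP + /(congr1 (@nat_of_ord _)) /eqP.
  by rewrite !val_Zp_nat //= => *; apply/andP.
rewrite -(card_ker_model CE) -(card_imset _ (bij_inj F_bij)).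
apply: eq_card => b; apply/imsetP/ker_lambdaP => [[a /ker_lambdaP Ka ->] c | K].
  by rewrite -(GK c) -Flambda Ka.
exists (G b); last by rewrite GK.
apply/ker_lambdaP => c; apply: (bij_inj F_bij).
by rewrite Flambda GK K.
Qed.

(** Two facts suffice: (1, 0) and (0, 1) generate the group and satisfy the relations, and every
    group generated by such a pair is an image of it. *)
Lemma model_presentation j (C : leftBrace ('Z_(p ^ 2) * 'Z_q)%type) :
  (forall u v, circ C u v = circ_ h j u v) ->
  ([set: circ_group C] \isog Grp (s : t :
             t ^+ q, s ^+ (p ^ 2), s * t * s^-1 = t ^+ (val h)))%g.
Proof.
move=> CE.
have mulE a b : (a * b)%g = circ_ h j a b :> circ_group C by rewrite -CE.
apply: intro_isoGrp.
  pose s : circ_group C := (1, 0); pose t : circ_group C := (0, 1).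
  have sX k : (s ^+ k)%g = (f j k%:R, 0).
    elim: k => [|k IHk]; first by rewrite expg0 circ_group1 f_0.
    rewrite expgS IHk mulE circ_1E mulr0 -nat1r f_add //.
    by rewrite f_1 mul1r.
  have tX k : (t ^+ k)%g = (0, k%:R).
    elim: k => [|k IHk]; first by rewrite expg0 circ_group1.
    by rewrite expgSr IHk mulE circ_0E natr1.
  have tsX (k : 'Z_(p ^ 2)) (m : 'Z_q) : (t ^+ m * s ^+ k)%g = (f j k, m).
    by rewrite sX tX mulE circ_0E addr0 !natr_Zp.
  apply/existsP; exists (s, t); rewrite /= !xpair_eqE; apply/and4P; split.
  - rewrite eqEsubset subsetT; apply/subsetP => -[n m] _.
    have [k ->] := f_surj j n; rewrite -tsX groupM ?groupX //.
      by rewrite (subsetP (joing_subr _ _)) ?cycle_id.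
    by rewrite (subsetP (joing_subl _ _)) ?cycle_id.
  - by rewrite tX pchar_Zp // circ_group1.
  - by rewrite sX pchar_Zp // f_0 circ_group1.
  (* The relation is checked in the form s t = t^h s, which avoids computing an inverse. *)
  - rewrite -(can_eq (mulgK s)) mulgKV tX natr_Zp !mulE.
    by rewrite circ_1E circ_0E mulr0 mulr1 !addr0.
move=> rT H /existsP[[s t]] /=; rewrite !xpair_eqE.
case/and4P=> /eqP defH /eqP tq /eqP sp2 /eqP st.
have t_natr n : (t ^+ (n%:R : 'Z_q))%g = (t ^+ n)%g.
  by rewrite val_Zp_nat // expg_mod.
have val1 N : (1 < N)%N -> (1%R : 'Z_N) = 1%N :> nat.
  by move=> N_gt1; rewrite -[1%R]/(1%:R) val_Zp_nat // modn_small.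
have stn k n : (s ^+ k * t ^+ n = t ^+ (val h ^ k * n)%N * s ^+ k)%g.
  have st1 i : (s * t ^+ i = t ^+ (val h * i)%N * s)%g.
    have tJ x : (x ^ s^-1 = s * x * s^-1)%g by rewrite conjgE invgK mulgA.
    by apply: (canRL (mulgKV s)); rewrite expgM -st -!tJ conjXg.
  elim: k n => [|k IHk] n; first by rewrite !expg0 mulg1 mul1g mul1n.
  by rewrite expgSr -mulgA st1 mulgA IHk -mulgA -expgSr expnSr mulnA.
have stX k (m : 'Z_q) : (s ^+ k * t ^+ m = t ^+ (val h ^+ k * m)%R * s ^+ k)%g.
  by rewrite stn -t_natr natrM natrX !natr_Zp.
(* An element (f_j(k), m) has normal form t^m s^k; [phi] evaluates this form in the target, and
   [stX] makes it multiplicative. *)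
pose phi (a : circ_group C) : rT :=
  (t ^+ (a.2 : 'Z_q) * s ^+ (finv (f j) a.1 : 'Z_(p ^ 2)))%g.
have phiE k m : phi (f j k, m) = (t ^+ m * s ^+ k)%g.
  by rewrite /phi /= (finv_f (@f_inj _ p_pr j)).
have phiM : {in [set: circ_group C] &, {morph phi : a b / (a * b)%g}}.
  move=> [n m] [x y] _ _; have [k ->] := f_surj j n; have [l ->] := f_surj j x.
  rewrite mulE circ_ffE !phiE.
  rewrite !expgD_Zp ?order_dvdn ?tq ?sp2 ?(ltnW q_gt1) ?(ltnW p2_gt1) //.
  by rewrite !mulgA; congr (_ * _)%g; rewrite -!mulgA stX.
apply/homgP; exists (Morphism phiM); apply/eqP.
rewrite eqEsubset -defH; apply/andP; split.
  apply/subsetP=> _ /morphimP[a _ _ ->] /=; rewrite /phi groupM ?groupX //.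
    by rewrite (subsetP (joing_subr _ _)) ?cycle_id.
  by rewrite (subsetP (joing_subl _ _)) ?cycle_id.
rewrite join_subG !cycle_subG; apply/andP; split; apply/morphimP.
  exists ((1, 0) : circ_group C); rewrite ?inE //=.
  by rewrite -(f_1 p j) phiE mul1g val1.
exists ((0, 1) : circ_group C); rewrite ?inE //=.
by rewrite -(f_0 p j) phiE mulg1 val1.
Qed.

End Model.

(** * Congruences, multiples by residue classes, and o-powers *)

(** By Bezout u a = v b + 1, so 1 = c^(u a) = c^(v b) c = c modulo m. *)
Lemma expn_coprime_eq1 c a b m : (0 < a)%N -> coprime a b ->
  c ^ a = 1 %[mod m] -> c ^ b = 1 %[mod m] -> c = 1 %[mod m].
Proof.
move=> a_gt0 /eqP co ca cb; case: (egcdnP b a_gt0) => u v + _.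
rewrite co => /(congr1 (fun k => c ^ k %% m)%N).
rewrite mulnC expnM -modnXm ca modnXm exp1n expnD expn1 [(v * b)%N]mulnC expnM.
by rewrite -modnMml -[in RHS]modnXm cb modnXm exp1n modnMml mul1n.
Qed.

Lemma expn_eq1_coprime c n m : (0 < n)%N -> c ^ n = 1 %[mod m] -> coprime m c.
Proof.
move=> n_gt0 cn; rewrite -(coprime_pexpr _ _ n_gt0) -coprime_modr cn.
by rewrite coprime_modr coprimen1.
Qed.

Lemma eqmod_natr_Zp N m n :
  (1 < N)%N -> m%:R = n%:R :> 'Z_N -> m = n %[mod N].
Proof. by move=> N_gt1 /(congr1 (@nat_of_ord _)); rewrite !val_Zp_nat. Qed.

Lemma Zp_dvdn_eq0 N (a : 'Z_N) : (1 < N)%N -> (N %| a)%N -> a = 0.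
Proof.
by move=> N_gt1 /dvdnP[k ak]; rewrite -(natr_Zp a) ak natrM pchar_Zp // mulr0.
Qed.

Section MulrnZp.
Variables (T : zmodType) (N : nat) (x : T).
Hypotheses (N_gt1 : (1 < N)%N) (xN : x *+ N = 0).

Lemma mulrn_mod k : x *+ (k %% N)%N = x *+ k.
Proof.
by rewrite [in RHS](divn_eq k N) mulrnDr mulnC mulrnA xN mul0rn add0r.
Qed.

Lemma mulrn_natr k : x *+ (k%:R : 'Z_N) = x *+ k.
Proof. by rewrite val_Zp_nat // mulrn_mod. Qed.

Lemma mulrn_ZpD (a b : 'Z_N) : x *+ (a + b)%R = x *+ a + x *+ b.
Proof.
by rewrite -{1}(natr_Zp a) -{1}(natr_Zp b) -natrD mulrn_natr mulrnDr.
Qed.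

Lemma mulrn_ZpM (a b : 'Z_N) : x *+ (a * b)%R = x *+ b *+ a.
Proof.
by rewrite -{1}(natr_Zp a) -{1}(natr_Zp b) -natrM mulrn_natr mulnC mulrnA.
Qed.

End MulrnZp.

(** Induction on k: the k-th o-power of g acts as c^k = k p j + 1 modulo p^2, and f_j(k + 1) =
    f_j(k) + (k p j + 1) f_j(1) with f_j(1) = 1. *)
Lemma expg_circ_f p (T : finZmodType) (C : leftBrace T) (g : circ_group C)
    c j k :
  prime p -> odd p -> (forall b, lambda C g b = b *+ c) ->
  (g : T) *+ (p ^ 2) = 0 -> c%:R = 1 + p%:R * j%:R :> 'Z_(p ^ 2) ->
  (g ^+ k)%g = (g : T) *+ (@f_ p j k%:R) :> T.
Proof.
move=> p_pr p_odd gE gp2 cE; have p2_gt1 := sqr_prime_gt1 p_pr.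
elim: k => [|k IHk]; first by rewrite expg0 circ_group1 f_0.
rewrite expgSr circ_groupM circE (lambda_expg k gE) IHk -natr1 f_add // f_1.
rewrite mulr1 [in RHS]mulrn_ZpD //; congr (_ + _).
by rewrite -exp1Dp // -cE -natrX mulrn_natr.
Qed.

(** * Every brace with the required invariants is isomorphic to a model *)

Section Classification.
Variables (p q : nat) (h : {unit 'Z_q}).
Hypotheses (p_pr : prime p) (p_odd : odd p) (q_pr : prime q).
Hypotheses (q1 : q = 1 %[mod p ^ 2]) (oh : #[h]%g = (p ^ 2)%N).

Local Notation f := (@f_ p).
Let p2_gt1 := sqr_prime_gt1 p_pr.
Let q_gt1 := prime_gt1 q_pr.
Let p_q := coprime_p2q p_pr q_pr q1.

Lemma prime_ltn : (p < q)%N.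
Proof.
apply: leq_ltn_trans (sqr_prime_ltn p_pr q_pr q1).
by rewrite -[leqLHS]expn1 leq_pexp2l // prime_gt0.
Qed.

Variables (T : finZmodType) (C : leftBrace T).
Hypotheses (cardT : #|T| = (p ^ 2 * q)%N) (cardK : #|ker_lambda C| = q).

(** Lagrange in (T, o) gives the exponent p^2 q and Fermat gives p - 1. These are coprime because q
    exceeds p - 1. *)
Lemma lambda_mod_p a c :
  (forall b, lambda C a b = b *+ c) ->
  (exists x : T, #[x]%g = (p ^ 2 * q)%N) -> c = 1 %[mod p].
Proof.
move=> aE [x ox].
have cN : c ^ (p ^ 2 * q) = 1 %[mod p].
  have := lambda_expg (a := (a : circ_group C)) (p ^ 2 * q) aE x.
  have ->: ((a : circ_group C) ^+ (p ^ 2 * q))%g = 1%g.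
    by rewrite -cardT -cardsT expg_cardG ?inE.
  rewrite circ_group1 lambda0l -[LHS]mulr1n -!FinRing.zmodXgE => /esym/eqP.
  rewrite eq_expg_mod_order ox => /eqP /(congr1 (fun k => k %% p)%N).
  by rewrite !modn_dvdm // dvdn_mulr // dvdn_exp.
have p_gt1 := prime_gt1 p_pr.
apply: (@expn_coprime_eq1 c (p ^ 2 * q) p.-1) => //.
- by rewrite muln_gt0 expn_gt0 !prime_gt0.
- rewrite coprimeMl coprimeXl ?coprimenP ?prime_gt0 //=.
  rewrite prime_coprime // gtnNdvd //; first by rewrite -ltnS prednK ?prime_gt0.
  by rewrite (leq_ltn_trans (leq_pred _)) ?prime_ltn.
- rewrite -totient_prime //; apply: Euler_exp_totient.
  rewrite coprime_sym (expn_eq1_coprime _ cN) //.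
  by rewrite muln_gt0 expn_gt0 !prime_gt0.
Qed.

Lemma lambda_decomp c : c = 1 %[mod p] ->
  c%:R = 1 + p%:R * (c %/ p)%:R :> 'Z_(p ^ 2).
Proof.
move=> c1; rewrite {1}(divn_eq c p) c1 modn_small ?prime_gt1 //.
by rewrite natrD natrM addrC mulrC.
Qed.

Lemma brace_isom_model : cyclic [set: T] ->
  exists j : 'I_p, forall D : leftBrace ('Z_(p ^ 2) * 'Z_q)%type,
    (forall u v, circ D u v = circ_ h j u v) -> brace_isom C D.
Proof.
case/cyclicP=> x xgen.
have ox : #[x]%g = (p ^ 2 * q)%N by rewrite orderE -xgen cardsT.
have xE b : exists i, b = x *+ i.
  have /cycleP[i ->] : b \in <[x]>%g by rewrite -xgen inE.
  by exists i; rewrite FinRing.zmodXgE.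
have x_eq m n : x *+ m = x *+ n -> m = n %[mod p ^ 2 * q].
  by rewrite -!FinRing.zmodXgE => /eqP; rewrite eq_expg_mod_order ox => /eqP.
have x0 n : (x *+ n == 0) = (p ^ 2 * q %| n)%N.
  by rewrite -ox order_dvdn FinRing.zmodXgE FinRing.zmod1gE.
have lambdaE a : exists c, forall b, lambda C a b = b *+ c.
  have [c xc] := xE (lambda C a x); exists c => b.
  by have [i ->] := xE b; rewrite lambdaMn xc mulrnAC.
(* Generators of the additive subgroups of orders q and p^2. *)
pose t := x *+ (p ^ 2)%N; pose P := x *+ q.
have tq : t *+ q = 0 by apply/eqP; rewrite -mulrnA x0.
have Pp2 : P *+ (p ^ 2) = 0 by apply/eqP; rewrite -mulrnA x0 mulnC.
have P0 n : P *+ n = 0 -> (p ^ 2 %| n)%N.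
  by move/eqP; rewrite -mulrnA x0 mulnC dvdn_pmul2l ?prime_gt0.
have t0 n : t *+ n = 0 -> (q %| n)%N.
  by move/eqP; rewrite -mulrnA x0 dvdn_pmul2l ?expn_gt0 ?prime_gt0.
(* A cyclic group has only one subgroup of order q. *)
have kerE : ker_lambda C = <[t]>%g.
  have cycT : cyclic [set: T] by apply/cyclicP; exists x.
  apply/eqP; rewrite (eq_subG_cyclic cycT) ?subsetT // ?cycle_subG ?inE //.
  rewrite cardK -orderE /t -FinRing.zmodXgE orderXdiv ox; last exact: dvdn_mulr.
  by rewrite mulKn // expn_gt0 prime_gt0.
have [c Pc] := lambdaE P.
have c1 : c = 1 %[mod p] by apply: lambda_mod_p Pc _; exists x.
have cE := lambda_decomp c1; set s := (c %/ p)%N in cE.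
have PX k := @expg_circ_f p T C P c s k p_pr p_odd Pc Pp2 cE.
have Pexp_p2 : ((P : circ_group C) ^+ (p ^ 2))%g = 1%g.
  by rewrite PX pchar_Zp // f_0 circ_group1.
have cp2 : c ^ (p ^ 2) = 1 %[mod p ^ 2 * q].
  apply: x_eq; rewrite -(lambda_expg (a := (P : circ_group C)) _ Pc) Pexp_p2.
  by rewrite circ_group1 lambda0l.
have xN : x *+ (p ^ 2 * q) = 0 by apply/eqP; rewrite x0.
(* Since c = 1 modulo p, c^p = 1 modulo p^2 in any case. If this also held modulo q, then p P, the
   p-th o-power of P, would lie in the kernel and be killed by q, forcing p to divide q. *)
have cp : c ^ p != 1 %[mod q].
  apply/eqP => cp.
  have cp' : c ^ p = 1 %[mod p ^ 2 * q].
    apply/eqP; rewrite chinese_remainder // cp eqxx andbT; apply/eqP.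
    apply: eqmod_natr_Zp => //.
    by rewrite natrX cE exp1Dp // char_Zp2 // mul0r add0r.
  have : ((P : circ_group C) ^+ p)%g \in ker_lambda C.
    apply/ker_lambdaP => b; rewrite (lambda_expg _ Pc).
    have [i ->] := xE b.
    by rewrite mulrnAC -(mulrn_mod xN) cp' (mulrn_mod xN).
  rewrite kerE PX f_p // mulrn_natr // => /cycleP[i].
  rewrite FinRing.zmodXgE => /(congr1 (fun b => b *+ q)).
  rewrite [RHS]mulrnAC tq mul0rn -mulrnA => /P0.
  rewrite -mulnn dvdn_pmul2l ?prime_gt0 // dvdn_prime2 // => /eqP pq.
  by have := prime_ltn; rewrite pq ltnn.
have cp2q : c ^ (p ^ 2) = 1 %[mod q].
  by move/(congr1 (fun k => k %% q)%N): cp2; rewrite !modn_dvdm // dvdn_mull.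
have Uc : (c%:R : 'Z_q) \is a GRing.unit.
  by rewrite unitZpE // (expn_eq1_coprime _ cp2q) // expn_gt0 prime_gt0.
pose U : {unit 'Z_q} := FinRing.unit 'Z_q Uc.
have UX n : val (U ^+ n)%g = (c ^ n)%:R by rewrite FinRing.val_unitX natrX.
have oU : #[U]%g = (p ^ 2)%N.
  have /(dvdn_pfactor _ _ p_pr)[m m_le oU] : (#[U]%g %| p ^ 2)%N.
    rewrite order_dvdn; apply/eqP/val_inj; rewrite UX -Zp_nat_mod // cp2q.
    by rewrite Zp_nat_mod.
  move: m_le; rewrite leq_eqVlt => /predU1P[m2 | m_lt1]; first by rewrite oU m2.
  case/eqP: cp; apply: eqmod_natr_Zp => //; rewrite -UX.
  have /eqP -> // : (U ^+ p == 1)%g.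
  by rewrite -order_dvdn oU -[X in (_ %| X)%N]expn1 dvdn_exp2l.
(* The unit group modulo q is cyclic, so its elements [h] and [U] of equal order generate the same
   subgroup. *)
have hU : <[h]>%g = <[U]>%g.
  apply/eqP; rewrite (eq_subG_cyclic (units_Zp_cyclic q_pr)) ?subsetT //.
  by rewrite -!orderE oh oU.
have [r hr] : exists r, h = (U ^+ r)%g by apply/cycleP; rewrite -hU cycle_id.
have [e Ue] : exists e, U = (h ^+ e)%g by apply/cycleP; rewrite hU cycle_id.
(* This power is chosen so that lambda_g acts on the part of order q as h. *)
pose g : circ_group C := ((P : circ_group C) ^+ r)%g.
have gE b : lambda C g b = b *+ (c ^ r) by rewrite (lambda_expg _ Pc).
have cr1 : c ^ r = 1 %[mod p] by rewrite -modnXm c1 modnXm exp1n.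
pose j := Ordinal (ltn_pmod (c ^ r %/ p) (prime_gt0 p_pr)).
have crE : (c ^ r)%:R = 1 + p%:R * j%:R :> 'Z_(p ^ 2).
  rewrite lambda_decomp // -!natrM /= muln_modr mulnn.
  by rewrite Zp_nat_mod.
have gp2 : (g : T) *+ (p ^ 2) = 0 by rewrite /g PX mulrnAC Pp2 mul0rn.
have gX k := expg_circ_f k p_pr p_odd gE gp2 crE.
(* Since r e = 1 modulo p^2, the e-th o-power of g is P, and it is also the multiple f_j(e) g. Hence
   g has additive order p^2, like P. *)
have Pg : exists w, P = (g : T) *+ w.
  exists (f j e%:R : 'Z_(p ^ 2)); rewrite -gX -expgM.
  have : (U ^+ (r * e) == U ^+ 1)%g by rewrite expgM -hr -Ue expg1.
  rewrite eq_expg_mod_order oU => /eqP re.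
  by rewrite -(expg_mod _ Pexp_p2) re expg_mod.
have g0 n : (g : T) *+ n = 0 -> (p ^ 2 %| n)%N.
  by have [w Pw] := Pg => gn; apply: P0; rewrite Pw mulrnAC gn mul0rn.
have tker m : t *+ m \in ker_lambda C.
  by rewrite kerE -FinRing.zmodXgE mem_cycle.
have hE : val h = (c ^ r)%:R by rewrite hr UX.
exists j => D DE.
pose F (u : 'Z_(p ^ 2) * 'Z_q) := (g : T) *+ u.1 + t *+ u.2.
have FE n m : F (n, m) = (g : T) *+ n + t *+ m by [].
have FD u v : F (u + v) = F u + F v.
  by rewrite /F [(u + v).1]/= !mulrn_ZpD // addrACA.
(* Multiplying by p^2 kills the g-part and isolates m. *)
have F0 u : F u = 0 -> u = 0.
  case: u => n m; rewrite /F /= => nm.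
  have m0 : m = 0.
    have /(congr1 (fun b => b *+ (p ^ 2))) := nm.
    rewrite mulrnDl mulrnAC gp2 !mul0rn add0r -mulrnA => /t0.
    rewrite Gauss_dvdl 1?coprime_sym // => qm; exact: Zp_dvdn_eq0 qm.
  move: nm; rewrite m0 mulr0n addr0 => /g0 n0.
  by rewrite (Zp_dvdn_eq0 p2_gt1 n0).
have F_bij : bijective F.
  apply: inj_card_bij; last by rewrite cardT card_prod !card_ord !Zp_cast.
  move=> u v Fuv; apply/eqP; rewrite -subr_eq0; apply/eqP/F0.
  by apply: (addIr (F v)); rewrite -FD subrK add0r.
have Fcirc u v : F (circ D u v) = circ C (F u) (F v).
  case: u v => n m [y z]; rewrite DE.
  have [k ->] := f_surj p_pr j n; rewrite circ_fE //.
  (* F(f_j(k), m) is the o-product of m t, which acts trivially, with the k-th o-power of g. *)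
  have lamF b : lambda C (F (f j k, m)) b = b *+ ((c ^ r) ^ k).
    have -> : F (f j k, m) = circ C (t *+ m) (g ^+ k)%g.
      by rewrite circE (ker_lambdaP _ _ (tker m)) gX natr_Zp addrC.
    by rewrite lambda_circ (ker_lambdaP _ _ (tker m)) (lambda_expg _ gE).
  rewrite circE lamF.
  (* Both coefficients in the law of B_j, modulo p^2 and modulo q, are reductions of the single
     integer c^(r k). *)
  have -> : k * p%:R * j%:R + 1 = ((c ^ r) ^ k)%:R.
    by rewrite natrX crE exp1Dp // natr_Zp.
  have -> : val h ^+ k = ((c ^ r) ^ k)%:R.
    by rewrite hE [in RHS]natrX.
  (* Otherwise [mulrn_ZpD] unfolds [f] and splits the sum inside it. *)
  clear lamF; move: (f j k) => n1.
  rewrite !FE mulrnDl !mulrn_ZpD // !mulrn_ZpM //.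
  have yp2 : (g : T) *+ y *+ (p ^ 2) = 0 by rewrite mulrnAC gp2 mul0rn.
  have zq : t *+ z *+ q = 0 by rewrite mulrnAC tq mul0rn.
  rewrite !mulrn_natr //.
  exact: addrACA.
have [G FK GK] := F_bij.
exists G; split.
- by exists F.
- by move=> a b; apply: (can_inj FK); rewrite FD !GK.
- by move=> a b; apply: (can_inj FK); rewrite Fcirc !GK.
Qed.

End Classification.

Theorem proposition6p3 (p q : nat) (h : {unit 'Z_q}) :
  prime p -> odd p -> prime q -> q = 1 %[mod p ^ 2] -> #[h]%g = (p ^ 2)%N ->
  (forall j : 'I_p, bijective (@f_ p j)) /\
  exists B : 'I_p -> leftBrace ('Z_(p ^ 2) * 'Z_q)%type,
    [/\ forall (j : 'I_p) (u v : 'Z_(p ^ 2) * 'Z_q),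
          circ (B j) u v = circ_ h j u v,
        forall (T : finZmodType) (C : leftBrace T),
          [/\ #|T| = (p ^ 2 * q)%N, cyclic [set: T] & #|ker_lambda C| = q]
          <-> exists j : 'I_p, brace_isom C (B j),
        forall i j : 'I_p, brace_isom (B i) (B j) -> i = j
      & forall j : 'I_p,
          ([set: circ_group (B j)] \isog Grp (s : t :
             t ^+ q, s ^+ (p ^ 2), s * t * s^-1 = t ^+ (val h)))%g].
Proof.
move=> p_pr p_odd q_pr q1 oh; split; first by move=> j; apply/injF_bij/f_inj.
(* Choice over the finite index set gathers the separately obtained models into one family. *)
have [B BE] := fin_all_exists (fun j : 'I_p => model_brace p_pr p_odd oh j).
exists B; split=> //.
- move=> T C; split=> [[cardT cycT cardK] | [j]].
    have [j isoC] := brace_isom_model p_pr p_odd q_pr q1 oh cardT cardK cycT.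
    by exists j; apply: isoC.
  exact: isom_model (BE j).
- move=> i j isoB; apply/val_inj.
  have := model_isoms p_pr q_pr q1 oh (BE i) (BE j) isoB.
  by rewrite !modn_small.
- by move=> j; apply: model_presentation (BE j).
Qed.
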